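(* Assume that $\lambda_1>0$. There exists $\varepsilon>0$ such that, if $u$ is the solution of the patch problem (P) with a nonnegative, continuous and compactly supported initial datum $u_0\not\equiv0$ satisfying $\|u_0\|_{L^\infty(\mathbb{R})}\le\varepsilon$, then $u$ goes to extinction, that is, $\|u(t,\cdot)\|_{L^\infty(\mathbb{R})}\to0$ as $t\to+\infty$.
   Context: Setting. Let $l_1,l_2,d_1,d_2,\sigma>0$ and $l=l_1+l_2$. The real line is divided into patches of type 1 (KPP), $(nl-l_1,nl)$, and of type 2 (bistable), $(nl,nl+l_2)$, $n\in\mathbb{Z}$. Set $S_1=l\mathbb{Z}$, $S_2=l\mathbb{Z}+l_2$, $S=S_1\cup S_2$. Let $d(x)=d_1$, $f(x,s)=f_1(s)$ for $x\in(nl-l_1,nl)$ and $d(x)=d_2$, $f(x,s)=f_2(s)$ for $x\in(nl,nl+l_2)$. The functions $f_1,f_2\in C^1(\mathbb{R})$ satisfy, for some $K_1,K_2>0$ and $\theta\in(0,K_2)$: (KPP) $f_1(0)=f_1(K_1)=0$, $0<f_1(s)\le f_1'(0)s$ for $s\in(0,K_1)$, $f_1'(K_1)<0$, $f_1<0$ in $(-\infty,0)\cup(K_1,+\infty)$; (Bistable) $f_2(0)=f_2(\theta)=f_2(K_2)=0$, $f_2'(0)<0$, $f_2'(\theta)>0$, $f_2'(K_2)<0$, $f_2<0$ in $(0,\theta)\cup(K_2,+\infty)$, $f_2>0$ in $(-\infty,0)\cup(\theta,K_2)$. The patch problem (P) is $$\begin{cases}u_t-d(x)u_{xx}=f(x,u),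 & t>0,\ x\in\mathbb{R}\setminus S,\\ u(t,x^-)=u(t,x^+),\quad u_x(t,x^-)=\sigma u_x(t,x^+), & t>0,\ x\in S_1,\\ u(t,x^-)=u(t,x^+),\quad \sigma u_x(t,x^-)=u_x(t,x^+), & t>0,\ x\in S_2.\end{cases}$$ A solution with bounded, nonnegative, continuous initial datum $u_0$ is the (unique) continuous function $u$ on $[0,+\infty)\times\mathbb{R}$, bounded on $[0,T]\times\mathbb{R}$ for all $T>0$, with $u(0,\cdot)=u_0$, which is $C^1$ in $t$ and $C^2$ in $x$ on $(0,+\infty)\times\overline{I}$ for each patch $I$, and satisfies (P) classically. Periodic means $l$-periodic in $x$. Principal eigenvalue. $\lambda_1$ is the unique real number for which there is a (unique) continuous function $\phi:\mathbb{R}\to\mathbb{R}$, with $\phi|_{\overline{I}}\in C^\infty(\overline{I})$ for each patch $I$, such that $-d(x)\phi''(x)-f_s(x,0)\phi(x)=\lambda_1\phi(x)$ for $x\in\mathbb{R}\setminus S$, $\phi'(x^-)=\sigma\phi'(x^+)$ for $x\in S_1$, $\sigma\phi'(x^-)=\phi'(x^+)$ for $x\in S_2$, $\phi$ is periodic, $\phi>0$, $\|\phi\|_{L^\infty(\mathbb{R})}=1$. *)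

(* Defs.v *)
From HB Require Import structures.
From mathcomp Require Import all_boot all_order all_algebra.
From mathcomp Require Import all_classical all_reals all_analysis.

Set Implicit Arguments.
Unset Strict Implicit.
Unset Printing Implicit Defensive.

Import Order.TTheory GRing.Theory Num.Theory.
Import numFieldNormedType.Exports.

Local Open Scope classical_set_scope.
Local Open Scope ring_scope.

(* In ring_scope these notations denote formal derivatives of polynomials. *)
Local Notation "f ^`()" := (derive1 f) : ring_scope.
Local Notation "f ^` ( n )" := (derive1n n f) : ring_scope.

Section Reactions.
Context {R : realType}.
Implicit Types (f : R -> R) (K theta : R).

Definition C1 f : Prop := (forall s : R, derivable f s 1) /\ continuous f^`().

Record KPP f K : Prop := {
  kpp_C1 : C1 f;
  kpp_K_gt0 : 0 < K;
  kpp_f0 : f 0 = 0;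
  kpp_fK : f K = 0;
  kpp_bound : forall s : R, 0 < s < K -> 0 < f s <= f^`() 0 * s;
  kpp_dfK : f^`() K < 0;
  kpp_neg : forall s : R, s < 0 \/ K < s -> f s < 0 }.

Record bistable f theta K : Prop := {
  bistable_C1 : C1 f;
  bistable_theta : 0 < theta < K;
  bistable_f0 : f 0 = 0;
  bistable_ftheta : f theta = 0;
  bistable_fK : f K = 0;
  bistable_df0 : f^`() 0 < 0;
  bistable_dftheta : 0 < f^`() theta;
  bistable_dfK : f^`() K < 0;
  bistable_neg : forall s : R, 0 < s < theta \/ K < s -> f s < 0;
  bistable_pos : forall s : R, s < 0 \/ theta < s < K -> 0 < f s }.

End Reactions.

Section Patches.
Context {R : realType}.
Variables l1 l2 : R.

Let l := l1 + l2.

Definition S1 : set R := [set x | exists n : int, x = n%:~R * l].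
Definition S2 : set R := [set x | exists n : int, x = n%:~R * l + l2].
Definition interfaces : set R := S1 `|` S2.

(* [patch1 a b]: the open interval ]a, b[ is a patch of type 1. *)
Definition patch1 (a b : R) : Prop :=
  exists n : int, a = n%:~R * l - l1 /\ b = n%:~R * l.
Definition patch2 (a b : R) : Prop :=
  exists n : int, a = n%:~R * l /\ b = n%:~R * l + l2.
Definition patch (a b : R) : Prop := patch1 a b \/ patch2 a b.

(* The value at the interfaces is irrelevant: the equations are only required
   away from them. *)
Definition patchwise (T : Type) (v1 v2 : T) (x : R) : T :=
  if `[< exists a b, patch1 a b /\ a < x < b >] then v1 else v2.

End Patches.

Section Regularity.
Context {R : realType}.

(* The difference quotient only involves points of D, so that at an endpoint of
   an interval D this is the one-sided derivative. *)
Definition deriv_within (D : set R) (f : R -> R) (x df : R) : Prop :=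
  (f y - f x) / (y - x) @[y --> within D x^'] --> df.

Definition Cinfty_within (D : set R) (f : R -> R) : Prop :=
  exists fn : nat -> R -> R, fn 0%N = f /\
    forall (k : nat) (x : R), D x -> deriv_within D (fn k) x (fn k.+1 x).

(* C^1 in t and C^2 in x on ]0, +oo[ x D: the derivatives u_t, u_x and u_xx exist
   and are jointly continuous, including at the endpoints of D. *)
Definition C12_within (D : set R) (u : R -> R -> R) : Prop :=
  let Omega := [set z : R * R | 0 < z.1 /\ D z.2] in
  exists ut ux uxx : R -> R -> R,
    [/\ {within Omega, continuous (fun z => ut z.1 z.2)},
        {within Omega, continuous (fun z => ux z.1 z.2)},
        {within Omega, continuous (fun z => uxx z.1 z.2)} &
        forall t x : R, 0 < t -> D x ->
          [/\ is_derive t 1 (u ^~ x) (ut t x),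
              deriv_within D (u t) x (ux t x) &
              deriv_within D (ux t) x (uxx t x)] ].

Definition Linfty_norm (f : R -> R) : \bar R :=
  Lnorm (@lebesgue_measure R) +oo%E (EFin \o f).

(* [lim] takes a default value when the limit does not exist; below it is only
   applied to functions whose regularity up to the interfaces ensures that the
   one-sided limits exist. *)
Definition left_lim (f : R -> R) (x : R) : R := lim (f y @[y --> x^'-]).
Definition right_lim (f : R -> R) (x : R) : R := lim (f y @[y --> x^'+]).

End Regularity.

Section PatchProblem.
Context {R : realType}.
Variables l1 l2 d1 d2 sigma : R.
Variables f1 f2 : R -> R.

Let l := l1 + l2.
Let d : R -> R := patchwise l1 l2 d1 d2.
Let f : R -> R -> R := patchwise l1 l2 f1 f2.

Record patch_solution (u0 : R -> R) (u : R -> R -> R) : Prop := {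
  sol_continuous : {within [set z : R * R | 0 <= z.1],
                     continuous (fun z => u z.1 z.2)};
  sol_bounded : forall T : R, 0 < T ->
    [bounded u z.1 z.2 | z in [set z : R * R | 0 <= z.1 <= T]];
  sol_initial : u 0 = u0;
  sol_regular : forall a b, patch l1 l2 a b -> C12_within `[a, b] u;
  sol_equation : forall t x : R, 0 < t -> ~ interfaces l1 l2 x ->
    (u ^~ x)^`() t - d x * (u t)^`(2) x = f x (u t x);
  sol_interface1 : forall t x : R, 0 < t -> S1 l1 l2 x ->
    left_lim (u t) x = right_lim (u t) x /\
    left_lim (u t)^`() x = sigma * right_lim (u t)^`() x;
  sol_interface2 : forall t x : R, 0 < t -> S2 l1 l2 x ->
    left_lim (u t) x = right_lim (u t) x /\
    sigma * left_lim (u t)^`() x = right_lim (u t)^`() x }.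

Record principal_eigenfunction (lambda : R) (phi : R -> R) : Prop := {
  eig_continuous : continuous phi;
  eig_regular : forall a b, patch l1 l2 a b -> Cinfty_within `[a, b] phi;
  eig_equation : forall x : R, ~ interfaces l1 l2 x ->
    - d x * phi^`(2) x - (f x)^`() 0 * phi x = lambda * phi x;
  eig_interface1 : forall x : R, S1 l1 l2 x ->
    left_lim phi^`() x = sigma * right_lim phi^`() x;
  eig_interface2 : forall x : R, S2 l1 l2 x ->
    sigma * left_lim phi^`() x = right_lim phi^`() x;
  eig_periodic : forall x : R, phi (x + l) = phi x;
  eig_gt0 : forall x : R, 0 < phi x;
  eig_norm : Linfty_norm phi = 1%E }.

(* For positive l1, l2, d1, d2, sigma exactly one real number has this
   property, the principal eigenvalue. *)
Definition principal_eigenvalue (lambda : R) : Prop :=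
  exists phi, principal_eigenfunction lambda phi.

End PatchProblem.

(* Main.v *)
Require Import Defs.
From HB Require Import structures.
From mathcomp Require Import all_boot all_order all_algebra.
From mathcomp Require Import all_classical all_reals all_analysis.
From mathcomp Require Import ess_sup_inf ring lra.

Set Implicit Arguments.
Unset Strict Implicit.
Unset Printing Implicit Defensive.

Import Order.TTheory GRing.Theory Num.Theory.
Import numFieldNormedType.Exports.

Local Open Scope classical_set_scope.
Local Open Scope ring_scope.

(** Why the theorem holds.  Let phi be the principal eigenfunction and put
    mu = lambda1 / 2.  Since f1 and f2 are differentiable and vanish at 0, there
    is r > 0 such that f_i(s) <= (f_i'(0) + mu) s for 0 <= s <= r.  As long as
    delta phi <= r, the function w = delta e^(- mu t) phi(x) is then a
    supersolution of the patch problem: w_t - d w_xx equals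
    (f_s(x, 0) + lambda1 - mu) w = (f_s(x, 0) + mu) w >= f(x, w),
    and w satisfies the transmission conditions because phi does.  The function
    phi is continuous, positive and periodic, so it is bounded below by a positive
    constant; hence a small enough u0 is below delta phi, and comparison gives
    0 <= u <= w, where w tends to 0 uniformly in x.

    The analytic content is the comparison principle.  Both inequalities, u <= w
    and - u <= 0, are of the form  al u <= c e^(- mu t) phi,  treated once in
    [comparison_eigenfunction].  It rests on [parabolic_max_principle], a maximum
    principle on an unbounded line cut into patches, which has two difficulties.

    Unboundedness: a supremum over the line need not be attained.  One
    maximizes e^(- C t) v - eta psi, where psi tends to infinity, psi'' is bounded
    by a multiple of psi and psi' vanishes at all interfaces, so that subtracting
    psi does not disturb the transmission conditions.  Such a psi is 1 + q^2 with q
    a strictly increasing trigonometric primitive whose derivative vanishes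
    exactly on the interfaces ([penalty_patch]).

    Interfaces: if the maximum in x is attained at an interface, the left
    derivative is nonnegative and the right one nonpositive; they are
    proportional with a positive factor, so both vanish ([critical_at_max]).  A
    one-sided second-derivative test ([deriv2_within_max_le0]) then applies in
    one adjacent closed patch, where the equation holds up to the boundary by
    continuity ([solution_on_patch], [eigenfunction_on_patch]).  The
    Hopf lemma is thereby avoided. *)

Local Notation "f ^`()" := (derive1 f) : ring_scope.
Local Notation "f ^` ( n )" := (derive1n n f) : ring_scope.

(** * Derivatives relative to a set, and one-sided tests at a maximum *)

Lemma deriv_withinP (R : realType) (D : set R) (f : R -> R) (x df : R) :
  deriv_within D f x df <->
  (forall e : R, 0 < e -> exists2 r, 0 < r & forall y, D y -> y != x ->
     `|y - x| < r -> `|(f y - f x) / (y - x) - df| < e).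
Proof.
split=> [fdf e e0|fdf].
  have /cvgrPdistC_lt/(_ _ e0)[r /= r0 rP] := fdf.
  exists r => // y Dy yx yr; apply: (rP y) => //=.
  by rewrite distrC.
apply/cvgrPdistC_lt => e e0; have [r r0 rP] := fdf e e0.
exists r => //= y /= yr Dy yx; apply: rP => //.
by rewrite distrC.
Qed.

Lemma deriv_within_is_derive (R : realType) (D : set R) (f : R -> R) (x df : R) :
  is_derive x 1 f df -> deriv_within D f x df.
Proof.
move=> [fx <-]; apply/deriv_withinP => e e0.
have /cvgrPdistC_lt/(_ _ e0)[r /= r0 rP] := fx.
exists r => // y _ yx yr.
have := rP (y - x); rewrite /= sub0r normrN => /(_ yr).
by rewrite subr_eq0 => /(_ yx); rewrite [_%:A]mulr1 subrK [_ *: _]mulrC.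
Qed.

Lemma is_derive_deriv_within (R : realType) (D : set R) (f : R -> R) (x df : R) :
  nbhs x D -> deriv_within D f x df -> is_derive x 1 f df.
Proof.
move=> /nbhs_ballP[s /= s0 sD] /deriv_withinP fdf.
have H : h^-1 *: ((f \o shift x) h%:A - f x) @[h --> (0:R)^'] --> df.
  apply/cvgrPdistC_lt => e e0; have [r r0 rP] := fdf e e0.
  exists (Num.min r s); rewrite /= ?lt_min ?r0 // => h /=.
  rewrite sub0r normrN lt_min => /andP[hr hs] h0.
  have := rP (h + x).
  rewrite addrK [_%:A]mulr1 [_ *: _]mulrC; apply => //.
    by apply: sD; rewrite /ball/= opprD addrCA subrr addr0 normrN.
  by rewrite -subr_eq0 addrK.
split; first by apply/cvg_ex; exists df.
exact: cvg_lim.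
Qed.

Lemma deriv_within_lincomb (R : realType) (D : set R) (f g : R -> R)
    (a c x df dg : R) :
  deriv_within D f x df -> deriv_within D g x dg ->
  deriv_within D (fun y => a * f y + c * g y) x (a * df + c * dg).
Proof.
move=> fdf gdg.
rewrite /deriv_within [X in nbhs (X @ _)](_ : _ = fun y =>
    a * ((f y - f x) / (y - x)) + c * ((g y - g x) / (y - x))).
  by apply: cvgD; exact: cvgMl_tmp.
by apply/funext => y; ring.
Qed.

Lemma deriv_within_continuous (R : realType) (D : set R) (f df : R -> R) :
  (forall x, D x -> deriv_within D f x (df x)) -> {within D, continuous f}.
Proof.
move=> fdf; apply/subspace_continuousP => x Dx.
have /deriv_withinP/(_ 1 ltr01)[r r0 rP] := fdf _ Dx.
apply/cvgrPdistC_lt => e e0.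
have B0 : 0 < `|df x| + 1 by rewrite ltr_wpDl.
exists (Num.min r (e / (`|df x| + 1))) => /=; first by rewrite lt_min r0 divr_gt0.
move=> y /=; rewrite distrC lt_min ltr_pdivlMr// => /andP[yr ye] Dy.
have [->|yx] := eqVneq y x; first by rewrite subrr normr0.
have h0 : 0 < `|y - x| by rewrite normr_gt0 subr_eq0.
apply: le_lt_trans ye; rewrite mulrC -ler_pdivrMr// -normfV -normrM.
have := rP _ Dy yx yr => /ltW; rewrite -lerBlDl; apply: le_trans.
exact: lerB_dist.
Qed.

(** Supplies test points for limits within a closed interval, also when x is an
    endpoint. *)
Lemma itv_near_point (R : realType) (a b x r : R) : a < b -> a <= x <= b -> 0 < r ->
  exists y, [/\ a <= y <= b, y != x & `|y - x| < r].
Proof.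
move=> ab /andP[ax xb] r0; have [xb'|bx] := ltP x b.
  exists (x + Num.min (r / 2) (b - x)).
  have m0 : 0 < Num.min (r / 2) (b - x) by rewrite lt_min divr_gt0//= subr_gt0.
  have mr : Num.min (r / 2) (b - x) < r by rewrite gt_min; apply/orP; left; lra.
  have mb : Num.min (r / 2) (b - x) <= b - x by rewrite ge_min lexx orbT.
  split; [lra| |].
    by rewrite -subr_eq0 addrC addKr gt_eqF.
  by rewrite addrC addKr gtr0_norm.
have {}xb : x = b by apply/le_anti; rewrite xb.
exists (x - Num.min (r / 2) (b - a)).
have m0 : 0 < Num.min (r / 2) (b - a) by rewrite lt_min divr_gt0//= subr_gt0.
have mr : Num.min (r / 2) (b - a) < r by rewrite gt_min; apply/orP; left; lra.
have mb : Num.min (r / 2) (b - a) <= b - a by rewrite ge_min lexx orbT.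
split; [lra| |].
  by rewrite -subr_eq0 addrC addKr oppr_eq0 gt_eqF.
by rewrite addrC addKr normrN gtr0_norm.
Qed.

Lemma deriv_within_unique (R : realType) (a b x df dg : R) (f : R -> R) :
  a < b -> a <= x <= b ->
  deriv_within `[a, b] f x df -> deriv_within `[a, b] f x dg -> df = dg.
Proof.
move=> ab xab /deriv_withinP fdf /deriv_withinP fdg.
apply/eqP; rewrite -subr_eq0; apply: contraT; rewrite -normr_gt0 => e0.
have e2 : 0 < `|df - dg| / 2 by rewrite divr_gt0.
have [r r0 rP] := fdf _ e2; have [s s0 sP] := fdg _ e2.
have [] := @itv_near_point R a b x (Num.min r s) ab xab.
  by rewrite lt_min r0.
move=> y [yab yx]; rewrite lt_min => /andP[yr ys].
have yD : (`[a, b]%classic : set R) y by rewrite /= in_itv.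
have := rP _ yD yx yr; have := sP _ yD yx ys.
set q := _ / _ => A B; have : `|df - dg| < `|df - dg| / 2 + `|df - dg| / 2.
  rewrite {1}(_ : df - dg = (q - dg) - (q - df)); last by ring.
  by rewrite (le_lt_trans (ler_normB _ _))//; lra.
by lra.
Qed.

(** Comparing x with points to its left suffices, so x may be the right endpoint. *)
Lemma deriv_within_max_ge0 (R : realType) (a b x m : R) (g : R -> R) :
  a < x <= b -> (forall y, a <= y <= b -> g y <= g x) ->
  deriv_within `[a, b] g x m -> 0 <= m.
Proof.
move=> /andP[ax xb] gx /deriv_withinP gm; rewrite leNgt; apply/negP => m0.
have [|r r0 rP] := gm (- m); first by lra.
have [] := @itv_near_point R a x x r ax _ r0; first by rewrite lexx ltW.
move=> y [/andP[ay yx] ynx yr].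
have yx' : y < x by rewrite lt_neqAle ynx.
have yab : a <= y <= b by lra.
have := rP y; rewrite /= in_itv/= yab => /(_ isT ynx yr).
have q0 : 0 <= (g y - g x) / (y - x).
  by rewrite mulr_le0 ?invr_le0 ?subr_le0 ?gx// ltW.
by rewrite ltr_norml => /andP[_]; lra.
Qed.

Lemma deriv_within_max_le0 (R : realType) (a b x m : R) (g : R -> R) :
  a <= x < b -> (forall y, a <= y <= b -> g y <= g x) ->
  deriv_within `[a, b] g x m -> m <= 0.
Proof.
move=> /andP[ax xb] gx /deriv_withinP gm; rewrite leNgt; apply/negP => m0.
have [r r0 rP] := gm m m0.
have [] := @itv_near_point R x b x r xb _ r0; first by rewrite lexx ltW.
move=> y [/andP[xy yb] ynx yr].
have yx' : x < y by rewrite lt_neqAle eq_sym ynx.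
have yab : a <= y <= b by lra.
have := rP y; rewrite /= in_itv/= yab => /(_ isT ynx yr).
have q0 : (g y - g x) / (y - x) <= 0.
  by rewrite mulr_le0_ge0 ?invr_ge0 ?subr_le0 ?gx// subr_ge0 ltW.
by rewrite ltr_norml => /andP[+ _]; lra.
Qed.

Lemma itv_interior_nbhs (R : realType) (a b x : R) :
  a < x < b -> nbhs x (`[a, b]%classic : set R).
Proof.
move=> xab; apply: (@filterS _ _ _ (`]a, b[%classic : set R)).
  exact: subset_itv_oo_cc.
by apply: open_nbhs_nbhs; split; [exact: itv_open|rewrite /= in_itv].
Qed.

Lemma deriv_within_MVT (R : realType) (a b x y : R) (g dg : R -> R) :
  a <= x -> x < y -> y <= b ->
  (forall z, a <= z <= b -> deriv_within `[a, b] g z (dg z)) ->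
  exists2 z, x < z < y & g y - g x = dg z * (y - x).
Proof.
move=> ax xy yb gdg.
have [||z] := @MVT R g dg x y xy.
- move=> z; rewrite in_itv/= => zxy.
  apply: (@is_derive_deriv_within _ (`[a, b]%classic)).
    by apply: itv_interior_nbhs; lra.
  by apply: gdg; lra.
- apply: (@continuous_subspaceW _ _ _ (`[a, b]%classic : set R)).
    by move=> z /=; rewrite !in_itv/=; lra.
  apply: (@deriv_within_continuous _ _ _ dg) => z /=; rewrite in_itv/=.
  exact: gdg.
- by rewrite in_itv/= => zxy gz; exists z.
Qed.

(** The usual second-derivative test with an endpoint allowed. At an endpoint a
    maximum does not force the first derivative to vanish; once it does, a positive
    second derivative would make [dg] have the sign of [y - x] near [x], and the mean
    value theorem would give a larger value of [g]. *)
Lemma deriv2_within_max_le0 (R : realType) (a b x L : R) (g dg : R -> R) :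
  a < b -> a <= x <= b -> (forall y, a <= y <= b -> g y <= g x) ->
  (forall y, a <= y <= b -> deriv_within `[a, b] g y (dg y)) ->
  dg x = 0 -> deriv_within `[a, b] dg x L -> L <= 0.
Proof.
move=> ab xab gx gdg dgx0 /deriv_withinP dgL; rewrite leNgt; apply/negP => L0.
have [r r0 rP] := dgL _ L0.
have sgn z : a <= z <= b -> z != x -> `|z - x| < r -> 0 < dg z / (z - x).
  move=> zab zx zr; have := rP z.
  rewrite /= in_itv/= zab dgx0 subr0 => /(_ isT zx zr).
  by rewrite ltr_norml => /andP[+ _]; lra.
have [y [yab yx yr]] := @itv_near_point R a b x r ab xab r0.
have gyx := gx _ yab.
have [xy|xy|xy] := ltgtP x y; last by rewrite xy eqxx in yx.
  have [||z zxy gz] := @deriv_within_MVT R a b x y g dg _ xy _ gdg; [lra..|].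
  have : 0 < dg z / (z - x).
    apply: sgn; [lra|rewrite gt_eqF//; lra|].
    by move: yr; rewrite !gtr0_norm; lra.
  rewrite pmulr_lgt0 ?invr_gt0; last by lra.
  move=> dgz; have : 0 < dg z * (y - x) by rewrite mulr_gt0//; lra.
  lra.
have [||z zxy gz] := @deriv_within_MVT R a b y x g dg _ xy _ gdg; [lra..|].
have : 0 < dg z / (z - x).
  apply: sgn; [lra|rewrite lt_eqF//; lra|].
  by move: yr; rewrite !ltr0_norm; lra.
rewrite nmulr_lgt0 ?invr_lt0; last by lra.
move=> dgz; have : 0 < - dg z * (x - y) by rewrite mulr_gt0//; lra.
lra.
Qed.

(** * A maximum principle on a line cut into patches *)

(** A purely pointwise notion: the maximum principle evaluates the equation only at
    a maximum, possibly on the boundary of the patch. *)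
Definition parabolic_jet (R : realType) (D : set R) (v vt vx vxx : R -> R -> R) :=
  forall t x : R, 0 < t -> D x ->
    [/\ is_derive t 1 (v ^~ x) (vt t x), deriv_within D (v t) x (vx t x) &
        deriv_within D (vx t) x (vxx t x)].

(** [P a b] means that the closed interval from a to b is one of the patches; the last
    two fields say that each endpoint is shared with a neighbouring patch. *)
Record tiling (R : realType) (P : R -> R -> Prop) : Prop := {
  tile_lt : forall a b, P a b -> a < b;
  tile_cover : forall x, exists a b, P a b /\ a <= x <= b;
  tile_left : forall a b, P a b -> exists c, P c a;
  tile_right : forall a b, P a b -> exists c, P b c }.

(** The correction that makes suprema over the line attained. The flatness at the
    endpoints of the patches is what keeps transmission conditions intact, whatever
    their ratio of slopes; the bound on [psi2] lets an exponential factor in time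
    absorb the diffusion of [psi]. *)
Record penalty (R : realType) (P : R -> R -> Prop) (kappa : R)
    (psi psi1 psi2 : R -> R) : Prop := {
  penalty_d1 : forall x : R, is_derive x 1 psi (psi1 x);
  penalty_d2 : forall x : R, is_derive x 1 psi1 (psi2 x);
  penalty_flat : forall a b, P a b -> psi1 a = 0 /\ psi1 b = 0;
  penalty_gt0 : forall x, 0 < psi x;
  penalty_d2_le : forall x, psi2 x <= kappa * psi x;
  penalty_pinfty : forall B, exists A, forall x, A < `|x| -> B < psi x }.

(** At an interface the two one-sided slopes have opposite signs because [x] is a
    maximum, and the same sign because they are proportional with a positive
    factor: both vanish, and either adjacent patch will do. *)
Lemma critical_at_max (R : realType) (P : R -> R -> Prop) (x : R) (g : R -> R) :
  tiling P ->
  (forall a b, P a b -> exists dg, forall y, a <= y <= b ->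
    deriv_within `[a, b] g y (dg y)) ->
  (forall a b m p, P a x -> P x b -> deriv_within `[a, x] g x m ->
    deriv_within `[x, b] g x p -> exists2 s, 0 < s & m = s * p) ->
  (forall y, g y <= g x) ->
  exists a b, [/\ P a b, a <= x <= b & deriv_within `[a, b] g x 0].
Proof.
move=> PP gdg tr gx.
have key a b : P a x -> P x b -> exists a b, [/\ P a b, a <= x <= b &
    deriv_within `[a, b] g x 0].
  move=> Pax Pxb; have [dg1 gdg1] := gdg _ _ Pax; have [dg2 gdg2] := gdg _ _ Pxb.
  have ax := tile_lt PP Pax; have xb := tile_lt PP Pxb.
  have xax : a <= x <= x by rewrite lexx ltW.
  have xxb : x <= x <= b by rewrite lexx ltW.
  have m0 : 0 <= dg1 x.
    by apply: (@deriv_within_max_ge0 R a x x _ g _ _ (gdg1 _ xax)); rewrite ?ax ?lexx.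
  have p0 : dg2 x <= 0.
    by apply: (@deriv_within_max_le0 R x b x _ g _ _ (gdg2 _ xxb)); rewrite ?xb ?lexx.
  have [s s0 msp] := tr _ _ _ _ Pax Pxb (gdg1 _ xax) (gdg2 _ xxb).
  have p00 : dg2 x = 0.
    by apply/le_anti; rewrite p0 -(pmulr_rge0 _ s0) -msp.
  by exists x, b; split => //; rewrite -p00; exact: gdg2.
have [a [b [Pab /andP[]]]] := tile_cover PP x.
rewrite le_eqVlt => /orP[/eqP ax _|ax].
  rewrite ax in Pab; have [c Pc] := tile_left PP Pab.
  exact: key Pc Pab.
rewrite le_eqVlt => /orP[/eqP xb|xb].
  rewrite -xb in Pab; have [c Pc] := tile_right PP Pab.
  exact: key Pab Pc.
have [dg gdgab] := gdg _ _ Pab.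
have xab : a <= x <= b by lra.
exists a, b; split => //.
have m0 : 0 <= dg x.
  by apply: (@deriv_within_max_ge0 R a b x _ g _ _ (gdgab _ xab)); rewrite ?ax ?ltW.
have p0 : dg x <= 0.
  by apply: (@deriv_within_max_le0 R a b x _ g _ _ (gdgab _ xab)); rewrite ?xb ?ltW.
by rewrite (_ : 0 = dg x); [exact: gdgab|apply/le_anti; rewrite m0].
Qed.

(** Outside a large interval the penalty exceeds the bound [B] on [v], so the
    supremum is that over a compact rectangle. *)
Lemma penalized_max_attained (R : realType) (psi : R -> R) (v : R -> R -> R)
    (B C eta t0 x0 : R) :
  continuous psi -> (forall x, 0 < psi x) ->
  (forall K, exists A, forall x, A < `|x| -> K < psi x) ->
  0 <= B -> 0 <= C -> 0 < eta -> 0 <= t0 ->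
  {within [set z : R * R | 0 <= z.1], continuous (fun z => v z.1 z.2)} ->
  (forall t x, 0 <= t <= t0 -> v t x <= B) ->
  let z t x := expR (- C * t) * v t x - eta * psi x in
  0 < z t0 x0 ->
  exists t1 x1, [/\ 0 <= t1 <= t0, 0 < z t1 x1 &
    forall t x, 0 <= t <= t0 -> z t x <= z t1 x1].
Proof.
move=> psic psi0 psioo B0 C0 eta0 t00 vc vB z z0.
have [A AP] := psioo (B / eta).
have [A' [AA' x0A']] : exists A', A <= A' /\ `|x0| <= A'.
  by exists (Num.max A `|x0|); rewrite !le_max !lexx orbT.
have A'0 : 0 <= A' by apply: le_trans x0A'.
pose K := (`[0, t0]%classic : set R) `*` (`[- A', A']%classic : set R).
have zc : {within K, continuous (fun w => z w.1 w.2)}.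
  apply: (@continuous_subspaceW _ _ _ [set w : R * R | 0 <= w.1]).
    by move=> w [/=]; rewrite in_itv/= => /andP[].
  move=> w; apply: cvgB; apply: cvgM.
  - move: w; apply: continuous_subspaceT => w.
    apply: (@continuous_comp _ _ _ (fun w : R * R => - C * w.1) expR).
      by apply: cvgM; [exact: cvg_cst|exact: cvg_fst].
    exact: continuous_expR.
  - exact: vc.
  - exact: cvg_cst.
  - move: w; apply: continuous_subspaceT => w.
    apply: (@continuous_comp _ _ _ snd psi); [exact: cvg_snd|exact: psic].
have K0 : K (t0, x0).
  by split; rewrite /= in_itv/= ?t00 ?lexx// -ler_norml.
have [||[t1 x1]] := compact_EVT_max _ _ zc; first by exists (t0, x0).
  by apply: compact_setX; exact: segment_compact.
rewrite inE => -[/=]; rewrite !in_itv/= => t1t0 x1A max1.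
have z01 : z t0 x0 <= z t1 x1 by apply: (max1 (t0, x0)); rewrite inE.
exists t1, x1; split => //; first exact: lt_le_trans z01.
move=> t x tt0; have [xA|xA] := leP `|x| A'.
  by apply: (max1 (t, x)); rewrite inE; split; rewrite /= in_itv//= -ler_norml.
apply: le_trans z01; apply/ltW/(le_lt_trans _ z0).
have : B < eta * psi x.
  by rewrite mulrC -ltr_pdivrMr//; apply: AP; exact: le_lt_trans xA.
have : expR (- C * t) * v t x <= B.
  apply: (@le_trans _ _ (expR (- C * t) * B)).
    by rewrite ler_wpM2l ?expR_ge0// vB.
  rewrite ler_piMl// -expR0 ler_expR mulNr oppr_le0 mulr_ge0//.
  by case/andP: tt0.
by rewrite /z; lra.
Qed.

(** At a positive maximum of  e^(- C t) v - eta psi,  the time derivative gives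
    v_t >= C v  and the space derivatives give
    e^(- C t) v_xx <= eta psi'' <= kappa eta psi <= kappa e^(- C t) v.  This
    contradicts  v_t - d v_xx <= M v  as soon as C > M + D kappa. *)
Lemma parabolic_max_principle (R : realType) (P : R -> R -> Prop)
    (kappa : R) (psi psi1 psi2 : R -> R) (D M T B : R) (v : R -> R -> R) :
  tiling P -> penalty P kappa psi psi1 psi2 ->
  0 <= kappa -> 0 <= D -> 0 <= M -> 0 <= B ->
  {within [set z : R * R | 0 <= z.1], continuous (fun z => v z.1 z.2)} ->
  (forall t x, 0 <= t <= T -> v t x <= B) ->
  (forall x, v 0 x <= 0) ->
  (forall a b, P a b -> exists vt vx vxx, parabolic_jet `[a, b] v vt vx vxx /\
    exists2 dd, 0 <= dd <= D & forall t x, 0 < t <= T -> a <= x <= b ->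
      0 < v t x -> vt t x - dd * vxx t x <= M * v t x) ->
  (forall a x b t m p, P a x -> P x b -> 0 < t ->
    deriv_within `[a, x] (v t) x m -> deriv_within `[x, b] (v t) x p ->
    exists2 s, 0 < s & m = s * p) ->
  forall t x, 0 <= t <= T -> v t x <= 0.
Proof.
move=> PP pen kappa0 D0 M0 B0 vc vB v0 vjet vtr t0 x0 /andP[t00 t0T].
rewrite leNgt; apply/negP => vt0x0.
(* The margin 1 makes the final inequality strict. *)
pose C := M + D * kappa + 1.
have C0 : 0 <= C by rewrite !addr_ge0 ?mulr_ge0.
(* Half of the value that would cancel the positive quantity at (t0, x0). *)
pose eta := expR (- C * t0) * v t0 x0 / (2 * psi x0).
have psi0 := penalty_gt0 pen.
have eta0 : 0 < eta by rewrite divr_gt0// mulr_gt0// expR_gt0.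
have psic : continuous psi.
  move=> x; apply: differentiable_continuous; apply/derivable1_diffP.
  exact: (ex_derive (is_derive := penalty_d1 pen x)).
have [||t1 [x1 [t1t0]]] := @penalized_max_attained R psi v B C eta t0 x0 psic psi0
  (penalty_pinfty pen) B0 C0 eta0 t00 vc.
- by move=> t x tt0; apply: vB; lra.
- rewrite (_ : eta * psi x0 = expR (- C * t0) * v t0 x0 / 2).
    have : 0 < expR (- C * t0) * v t0 x0 by rewrite mulr_gt0// expR_gt0.
    by move=> ?; lra.
  by rewrite /eta; field; rewrite gt_eqF.
set E := expR (- C * t1) => z1 max1.
have Ev : 0 < E * v t1 x1.
  by move: z1; rewrite subr_gt0; apply: le_lt_trans; rewrite mulr_ge0 ?ltW.
have v1 : 0 < v t1 x1 by move: Ev; rewrite pmulr_rgt0// expR_gt0.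
have t1_gt0 : 0 < t1.
  rewrite lt_neqAle eq_sym; apply/andP; split; last by case/andP: t1t0.
  by apply/eqP => t10; move: v1; rewrite t10 ltNge v0.
pose g y := E * v t1 y + - eta * psi y.
have [|||a [b [Pab x1ab gx1]]] := @critical_at_max R P x1 g PP.
- move=> a b Pab; have [vt [vx [vxx [J _]]]] := vjet _ _ Pab.
  exists (fun y => E * vx t1 y + - eta * psi1 y) => y yab.
  have [|_ Jx _] := J t1 y t1_gt0; first by rewrite /= in_itv.
  apply: deriv_within_lincomb => //.
  by apply: deriv_within_is_derive; exact: penalty_d1 pen _.
- move=> a b m p Pax Pxb gm gp.
  have [_ fl1] := penalty_flat pen Pax.
  have ax := tile_lt PP Pax; have xb := tile_lt PP Pxb.
  have [vt [vx [vxx [J _]]]] := vjet _ _ Pax.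
  have [wt [wx [wxx [J' _]]]] := vjet _ _ Pxb.
  have [|_ Jx _] := J t1 x1 t1_gt0; first by rewrite /= in_itv/= lexx ltW.
  have [|_ Jx' _] := J' t1 x1 t1_gt0; first by rewrite /= in_itv/= lexx ltW.
  have [s s0 sP] := vtr _ _ _ _ _ _ Pax Pxb t1_gt0 Jx Jx'.
  exists s => //.
  have -> : m = E * vx t1 x1 + - eta * psi1 x1.
    apply: (deriv_within_unique ax _ gm); first by rewrite lexx ltW.
    apply: deriv_within_lincomb => //.
    by apply: deriv_within_is_derive; exact: penalty_d1 pen _.
  have -> : p = E * wx t1 x1 + - eta * psi1 x1.
    apply: (deriv_within_unique xb _ gp); first by rewrite lexx ltW.
    apply: deriv_within_lincomb => //.
    by apply: deriv_within_is_derive; exact: penalty_d1 pen _.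
  by rewrite fl1 sP; ring.
- by move=> y; rewrite /g !mulNr; exact: max1.
have ab := tile_lt PP Pab.
have [vt [vx [vxx [J [dd /andP[dd0 ddD] ineq]]]]] := vjet _ _ Pab.
have x1D : (`[a, b]%classic : set R) x1 by rewrite /= in_itv.
have [Jt Jx Jxx] := J t1 x1 t1_gt0 x1D.
have gJ y : a <= y <= b ->
    deriv_within `[a, b] g y (E * vx t1 y + - eta * psi1 y).
  move=> yab; have [|_ Jy _] := J t1 y t1_gt0; first by rewrite /= in_itv.
  apply: deriv_within_lincomb => //.
  by apply: deriv_within_is_derive; exact: penalty_d1 pen _.
have xx_le0 : E * vxx t1 x1 + - eta * psi2 x1 <= 0.
  apply: (@deriv2_within_max_le0 R a b x1 _ g _ ab x1ab _ gJ).
  - by move=> y _; rewrite /g !mulNr; exact: max1.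
  - exact: deriv_within_unique ab x1ab (gJ _ x1ab) gx1.
  - apply: deriv_within_lincomb => //.
    by apply: deriv_within_is_derive; exact: penalty_d2 pen _.
have t_ge0 : 0 <= E * vt t1 x1 - C * (E * v t1 x1).
  apply: (@deriv_within_max_ge0 R 0 t0 t1 _
    (fun t => expR (- C * t) * v t x1 - eta * psi x1)).
  - by rewrite t1_gt0; case/andP: t1t0.
  - by move=> t tt0; exact: max1.
  - apply: deriv_within_is_derive.
    apply: is_derive_eq.
    by rewrite -/E /GRing.scale/=; ring.
(* Multiply the differential inequality by E and insert the sign conditions. *)
have H := ineq t1 x1 _ x1ab v1.
have {}H : vt t1 x1 - dd * vxx t1 x1 <= M * v t1 x1.
  by apply: H; lra.
have E0 : 0 < E := expR_gt0 _.
have H1 : E * vt t1 x1 - dd * (E * vxx t1 x1) <= M * (E * v t1 x1).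
  by have := ler_wpM2l (ltW E0) H; rewrite mulrBr; lra.
have H2 : dd * (E * vxx t1 x1) <= dd * (eta * psi2 x1).
  by apply: ler_wpM2l => //; lra.
have H3 : dd * (eta * psi2 x1) <= dd * (kappa * (E * v t1 x1)).
  apply: ler_wpM2l => //.
  apply: (@le_trans _ _ (eta * (kappa * psi x1))).
    by rewrite ler_pM2l//; exact: penalty_d2_le pen _.
  by rewrite mulrCA ler_wpM2l//; lra.
have H4 : dd * (kappa * (E * v t1 x1)) <= D * (kappa * (E * v t1 x1)).
  by rewrite ler_wpM2r// mulr_ge0// ltW.
have : C * (E * v t1 x1) = M * (E * v t1 x1) + D * (kappa * (E * v t1 x1)) + E * v t1 x1.
  by rewrite /C; ring.
lra.
Qed.

(** * Geometry of the patches and the penalty *)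

Lemma tiling_patch (R : realType) (l1 l2 : R) : 0 < l1 -> 0 < l2 ->
  tiling (Defs.patch l1 l2).
Proof.
move=> l1_gt0 l2_gt0; split.
- by move=> a b [] [n [-> ->]]; lra.
- move=> x; have l0 : 0 < l1 + l2 by lra.
  have /andP[] := floor_itv (x / (l1 + l2)).
  set n := Num.floor _; rewrite ler_pdivlMr// ltr_pdivrMr// => nx xn.
  have [xl2|xl2] := leP x (n%:~R * (l1 + l2) + l2).
    exists (n%:~R * (l1 + l2)), (n%:~R * (l1 + l2) + l2).
    by split; [right; exists n|rewrite nx].
  exists ((n + 1)%:~R * (l1 + l2) - l1), ((n + 1)%:~R * (l1 + l2)).
  split; first by left; exists (n + 1).
  rewrite (ltW xn) andbT; apply: le_trans (ltW xl2).
  by rewrite intrD mulrDl mul1r; lra.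
- move=> a b [] [n [-> _]].
    exists ((n - 1)%:~R * (l1 + l2)); right; exists (n - 1); split => //.
    by rewrite intrB; ring.
  by exists (n%:~R * (l1 + l2) - l1); left; exists n.
- move=> a b [] [n [_ ->]].
    by exists (n%:~R * (l1 + l2) + l2); right; exists n.
  exists ((n + 1)%:~R * (l1 + l2)); left; exists (n + 1); split => //.
  by rewrite intrD; ring.
Qed.

Lemma patch_ends (R : realType) (l1 l2 a b : R) : Defs.patch l1 l2 a b ->
  interfaces l1 l2 a /\ interfaces l1 l2 b.
Proof.
move=> [] [n [-> ->]]; split.
- right; exists (n - 1); rewrite intrB; ring.
- by left; exists n.
- by left; exists n.
- by right; exists n.
Qed.

Lemma periodicz (R : realType) (V : zmodType) (f : R -> V) (p : R) :
  periodic f p -> forall (n : int) (x : R), f (x + n%:~R * p) = f x.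
Proof.
move=> fp [n|n] x; first by rewrite mulr_natl periodicn.
rewrite NegzE -(periodicn fp n.+1 (x + _)); congr f.
by rewrite mulrNz mulNr mulr_natl subrK.
Qed.

(** The primitive of (c - cos th)^2, where th = 2 pi x / l - pi l2 / l and
    c = cos (pi l2 / l). At x = n l and at x = n l + l2 the angle th is, modulo 2 pi,
    - pi l2 / l and pi l2 / l respectively, so that the derivative vanishes there.
    Its mean c^2 + 1/2 is positive, whence the linear growth; squaring the factor
    c - cos th is what guarantees this, the unsquared one having mean c,
    which is 0 when l1 = l2. *)
Lemma increasing_flat_on_interfaces (R : realType) (l1 l2 : R) : 0 < l1 -> 0 < l2 ->
  exists q dq ddq : R -> R, exists c1 c2 : R,
  [/\ (forall x : R, is_derive x 1 q (dq x)),
      (forall x : R, is_derive x 1 dq (ddq x)),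
      (forall x, interfaces l1 l2 x -> dq x = 0),
      (forall x, `|x| <= 2 * `|q x| + c1) &
      (forall x, `|dq x| <= 4 /\ `|ddq x| <= c2)].
Proof.
move=> l1_gt0 l2_gt0; pose l := l1 + l2; have l0 : 0 < l by rewrite addr_gt0.
pose w := pi *+ 2 / l; have w0 : 0 < w by rewrite divr_gt0// pmulrn_lgt0// pi_gt0.
pose al := w * l2 / 2; pose c := cos al.
pose th x := w * x - al.
have dth (x : R) : is_derive x 1 th w.
  by apply: is_derive_eq; rewrite /GRing.scale/=; ring.
have c1 : `|c| <= 1 by rewrite ler_norml cos_geN1 cos_le1.
have cth x : `|cos (th x)| <= 1 by rewrite ler_norml cos_geN1 cos_le1.
have sth x : `|sin (th x)| <= 1 by rewrite ler_norml sin_geN1 sin_le1.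
exists (fun x => (c ^+ 2 + 2^-1) * x +
                 w^-1 * (2^-1 * (sin (th x) * cos (th x)) - 2 * c * sin (th x))).
exists (fun x => (c - cos (th x)) ^+ 2).
exists (fun x => 2 * w * (c - cos (th x)) * sin (th x)).
exists (6 / w), (4 * w); split.
- move=> x; apply: is_derive_eq; rewrite /GRing.scale/=.
  have := cos2Dsin2 (th x); set C := cos _; set S := sin _ => CS.
  have -> : (c - C) ^+ 2 = c ^+ 2 + 2^-1 * (C ^+ 2 + S ^+ 2) +
     w^-1 * (w * (2^-1 * (C ^+ 2 - S ^+ 2) - 2 * c * C)).
    by field; rewrite gt_eqF.
  by rewrite CS; ring.
- move=> x; apply: is_derive_eq; rewrite /GRing.scale/=; ring.
- move=> x xS; suff -> : cos (th x) = c by rewrite subrr expr0n.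
  have cosn := periodicz (@cosD2pi R).
  case: xS => -[n ->]; rewrite /th.
    rewrite /c -(cosN al) -(cosn n (- al)); congr cos.
    by rewrite /w -/l; field; rewrite gt_eqF.
  rewrite /c -(cosn n al); congr cos.
  by rewrite /al /w -/l; field; rewrite gt_eqF.
- move=> x; set r := w^-1 * _.
  have rw : `|r| <= 3 / w.
    rewrite normrM gtr0_norm ?invr_gt0// mulrC ler_pM2r ?invr_gt0//.
    rewrite (le_trans (ler_normB _ _))// !normrM.
    have := ler_pM (normr_ge0 _) (normr_ge0 _) (sth x) (cth x).
    have := ler_pM (normr_ge0 _) (normr_ge0 _) c1 (sth x).
    by rewrite (@ger0_norm _ 2^-1)// (@ger0_norm _ 2)//; lra.
  have ax : `|x| <= 2 * `|(c ^+ 2 + 2^-1) * x|.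
    rewrite normrM ger0_norm; last by rewrite addr_ge0// sqr_ge0.
    have := mulr_ge0 (sqr_ge0 c) (normr_ge0 x); lra.
  have := ler_normB ((c ^+ 2 + 2^-1) * x + r) r.
  by rewrite addrK; lra.
- move=> x; have c2 : `|c - cos (th x)| <= 2.
    by rewrite (le_trans (ler_normB _ _))//; have := cth x; lra.
  split.
    rewrite normrX; have := ler_pM (normr_ge0 _) (normr_ge0 _) c2 c2.
    by rewrite -expr2; lra.
  rewrite normrM -[leRHS]mulr1; apply: ler_pM => //.
  rewrite normrM ger0_norm; last by rewrite mulr_ge0// ltW.
  by have := ler_wpM2l (ltW w0) c2; lra.
Qed.

(** Take psi = 1 + q^2 with q as above: psi' = 2 q q' vanishes with q', and
    psi'' = 2 q'^2 + 2 q q'' is bounded by a multiple of 1 + q^2. *)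
Lemma penalty_patch (R : realType) (l1 l2 : R) : 0 < l1 -> 0 < l2 ->
  exists2 kappa : R, 0 <= kappa & exists psi psi1 psi2,
    penalty (Defs.patch l1 l2) kappa psi psi1 psi2.
Proof.
move=> l1_gt0 l2_gt0.
have [q [dq [ddq [c1 [c2 [qd dqd dq0 qx bd]]]]]] :=
  increasing_flat_on_interfaces l1_gt0 l2_gt0.
have c20 : 0 <= c2 by apply: le_trans (bd 0).2.
exists (32 + c2); first by rewrite addr_ge0.
exists (fun x => 1 + q x ^+ 2), (fun x => 2 * q x * dq x).
exists (fun x => 2 * dq x ^+ 2 + 2 * q x * ddq x); split.
- by move=> x; have := qd x; move=> ?; apply: is_derive_eq; rewrite /GRing.scale/=; ring.
- move=> x; have := qd x; have := dqd x; move=> ? ?.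
  by apply: is_derive_eq; rewrite /GRing.scale/=; ring.
- by move=> a b /patch_ends[/dq0 -> /dq0 ->]; rewrite !mulr0.
- by move=> x; rewrite ltr_wpDr// sqr_ge0.
- move=> x; have [dq4 ddqc] := bd x.
  have h1 : dq x ^+ 2 <= 16.
    rewrite -real_normK ?num_real//.
    have := lerXn2r 2 _ _ dq4; rewrite !nnegrE.
    move=> /(_ (normr_ge0 _)); lra.
  have h2 : 2 * q x * ddq x <= (2 * `|q x|) * c2.
    apply: (le_trans (ler_norm _)); rewrite normrM normrM gtr0_norm//.
    by rewrite ler_wpM2l// mulr_ge0.
  have h3 : (2 * `|q x|) * c2 <= (1 + q x ^+ 2) * c2.
    rewrite ler_wpM2r// -(real_normK (num_real (q x))).
    have := sqr_ge0 (1 - `|q x|). nra.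
  have := sqr_ge0 (q x). nra.
- move=> B; exists (B + c1) => x xB.
  have := qx x; have := sqr_ge0 (1 - `|q x|).
  rewrite -(real_normK (num_real (q x))). nra.
Qed.

(** * Derivatives at the interfaces and equations inside the patches *)

Lemma patches_disjoint (R : realType) (l1 l2 a b a' b' : R) :
  0 < l1 -> 0 < l2 -> patch1 l1 l2 a b -> patch2 l1 l2 a' b' ->
  b <= a' \/ b' <= a.
Proof.
move=> l10 l20 [n [-> ->]] [m [-> ->]]; have l0 : 0 < l1 + l2 by lra.
have [nm|mn] := leP n m; first by left; rewrite ler_pM2r// ler_int.
right; move: mn; rewrite -lezD1 -(ler_int R) -(ler_pM2r l0) intrD mulrDl; lra.
Qed.

(** The boolean tells the type of the patch. It is quantified before the values, so
    that a single choice selects the diffusion rate, the reaction and its slope at 0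
    consistently. *)
Lemma patchwise_patch (R : realType) (l1 l2 a b : R) :
  0 < l1 -> 0 < l2 -> Defs.patch l1 l2 a b ->
  exists i : bool, forall (T : Type) (v1 v2 : T) x, a < x < b ->
    patchwise l1 l2 v1 v2 x = if i then v1 else v2.
Proof.
move=> l10 l20 [] Pab; [exists true|exists false] => T v1 v2 x xab;
  rewrite /patchwise; case: asboolP => //.
  by move=> []; exists a, b.
move=> [a' [b' [P' x']]]; exfalso.
by case: (patches_disjoint l10 l20 P' Pab) => ?; lra.
Qed.

Lemma interior_not_interface (R : realType) (l1 l2 a b x : R) :
  0 < l1 -> 0 < l2 -> Defs.patch l1 l2 a b -> a < x < b -> ~ interfaces l1 l2 x.
Proof.
move=> l10 l20 [] Pab xab [] [n xn].
- have Pn : patch2 l1 l2 x (x + l2) by exists n; rewrite -xn.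
  by case: (patches_disjoint l10 l20 Pab Pn) => ?; lra.
- have Pn : patch2 l1 l2 (x - l2) x by exists n; rewrite xn; split; ring.
  by case: (patches_disjoint l10 l20 Pab Pn) => ?; lra.
- have Pn : patch1 l1 l2 (x - l1) x by exists n; rewrite -xn.
  by case: (patches_disjoint l10 l20 Pn Pab) => ?; lra.
- have Pn : patch1 l1 l2 x (x + l1).
    by exists (n + 1); rewrite xn intrD; split; ring.
  by case: (patches_disjoint l10 l20 Pn Pab) => ?; lra.
Qed.

Lemma derive1_interior (R : realType) (a b x : R) (g dg : R -> R) :
  (forall y, a <= y <= b -> deriv_within `[a, b] g y (dg y)) ->
  a < x < b -> g^`() x = dg x.
Proof.
move=> gdg xab.
have h : is_derive x 1 g (dg x).
  apply: (@is_derive_deriv_within _ (`[a, b]%classic)).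
    by apply: itv_interior_nbhs; lra.
  by apply: gdg; lra.
by rewrite derive1E derive_val.
Qed.

Lemma derive2_interior (R : realType) (a b x : R) (g dg ddg : R -> R) :
  (forall y, a <= y <= b -> deriv_within `[a, b] g y (dg y)) ->
  (forall y, a <= y <= b -> deriv_within `[a, b] dg y (ddg y)) ->
  a < x < b -> g^`(2) x = ddg x.
Proof.
move=> gdg dgddg xab; rewrite derive1nS derive1n1 -(derive1_interior dgddg xab).
rewrite [RHS]derive1E derive1E; apply: near_eq_derive.
have : nbhs x (`]a, b[%classic : set R).
  by apply: open_nbhs_nbhs; split; [exact: itv_open|rewrite /= in_itv].
apply: filterS => y; rewrite /= in_itv/= => yab.
exact: derive1_interior gdg yab.
Qed.

Lemma near_left_itv (R : realType) (a b : R) : a < b ->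
  \forall y \near b^'-, a < y < b.
Proof.
move=> ab; apply: filterS2 (nbhs_left_gt ab) (nbhs_left_lt b) => y ay yb.
by rewrite ay.
Qed.

Lemma near_right_itv (R : realType) (a b : R) : a < b ->
  \forall y \near a^'+, a < y < b.
Proof.
move=> ab; apply: filterS2 (nbhs_right_gt a) (nbhs_right_lt ab) => y ay yb.
by rewrite ay.
Qed.

(** The derivative taken in the line agrees with the one-sided one inside the
    patch, and the latter is continuous up to the endpoint because it has itself a
    derivative there. *)
Lemma left_lim_derive1 (R : realType) (a b : R) (g dg ddg : R -> R) : a < b ->
  (forall y, a <= y <= b -> deriv_within `[a, b] g y (dg y)) ->
  (forall y, a <= y <= b -> deriv_within `[a, b] dg y (ddg y)) ->
  left_lim g^`() b = dg b.
Proof.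
move=> ab gdg dgddg; apply/cvg_lim => //.
have /(continuous_within_itvP _ ab)[_ _ dgb] : {within `[a, b], continuous dg}.
  apply: (@deriv_within_continuous _ _ _ ddg) => z /=; rewrite in_itv/=.
  exact: dgddg.
apply: cvg_trans dgb; apply: near_eq_cvg.
by apply: filterS (near_left_itv ab) => y /(derive1_interior gdg).
Qed.

Lemma right_lim_derive1 (R : realType) (a b : R) (g dg ddg : R -> R) : a < b ->
  (forall y, a <= y <= b -> deriv_within `[a, b] g y (dg y)) ->
  (forall y, a <= y <= b -> deriv_within `[a, b] dg y (ddg y)) ->
  right_lim g^`() a = dg a.
Proof.
move=> ab gdg dgddg; apply/cvg_lim => //.
have /(continuous_within_itvP _ ab)[_ dga _] : {within `[a, b], continuous dg}.
  apply: (@deriv_within_continuous _ _ _ ddg) => z /=; rewrite in_itv/=.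
  exact: dgddg.
apply: cvg_trans dga; apply: near_eq_cvg.
by apply: filterS (near_right_itv ab) => y /(derive1_interior gdg).
Qed.

(** Used to extend an equation from an open patch to its closure. *)
Lemma within_itv_eq (R : realType) (a b : R) (g h : R -> R) : a < b ->
  {within `[a, b], continuous g} -> {within `[a, b], continuous h} ->
  (forall x, a < x < b -> g x = h x) -> forall x, a <= x <= b -> g x = h x.
Proof.
move=> ab /(continuous_within_itvP _ ab)[_ ga gb].
move=> /(continuous_within_itvP _ ab)[_ ha hb] gh x /andP[].
rewrite le_eqVlt => /orP[/eqP <- _|ax].
  apply: (@cvg_unique _ (@Rhausdorff R) _ _ _ _ ga).
  apply: cvg_trans ha; apply: near_eq_cvg.
  by apply: filterS (near_right_itv ab) => y /gh.
rewrite le_eqVlt => /orP[/eqP ->|xb]; last by apply: gh; rewrite ax.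
apply: (@cvg_unique _ (@Rhausdorff R) _ _ _ _ gb).
apply: cvg_trans hb; apply: near_eq_cvg.
by apply: filterS (near_left_itv ab) => y /gh.
Qed.

Lemma within_slice (R : realType) (D : set R) (G : R -> R -> R) (t : R) : 0 < t ->
  {within [set z : R * R | 0 < z.1 /\ D z.2], continuous (fun z => G z.1 z.2)} ->
  {within D, continuous (G t)}.
Proof.
move=> t0 /subspace_continuousP Gc; apply/subspace_continuousP => x Dx.
have := Gc (t, x) (conj t0 Dx); apply: cvg_trans => A /= [[U V] /= [tU xV]] UVA.
apply: filterS xV => y Vy Dy.
by apply: (UVA (t, y)) => //; split => //; exact: nbhs_singleton.
Qed.

(** * Comparison with a decaying multiple of the eigenfunction *)

Lemma continuous_C1 (R : realType) (f : R -> R) : C1 f -> continuous f.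
Proof.
move=> [fd _] x; apply: differentiable_continuous; apply/derivable1_diffP.
exact: fd.
Qed.

(** All terms of the equation are continuous up to the endpoints of the patch, so
    it holds there too, with one-sided derivatives. *)
Lemma solution_on_patch (R : realType) (l1 l2 d1 d2 sigma a b : R)
    (f1 f2 u0 : R -> R) (u : R -> R -> R) :
  0 < l1 -> 0 < l2 -> C1 f1 -> C1 f2 ->
  patch_solution l1 l2 d1 d2 sigma f1 f2 u0 u -> Defs.patch l1 l2 a b ->
  exists ut ux uxx, parabolic_jet `[a, b] u ut ux uxx /\
    forall i : bool,
      (forall (T : Type) (v1 v2 : T) x, a < x < b ->
        patchwise l1 l2 v1 v2 x = if i then v1 else v2) ->
      forall t x, 0 < t -> a <= x <= b ->
      ut t x - (if i then d1 else d2) * uxx t x = (if i then f1 else f2) (u t x).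
Proof.
move=> l10 l20 f1C f2C usol Pab.
have ab := tile_lt (tiling_patch l10 l20) Pab.
have [ut [ux [uxx [utc _ uxxc J]]]] := sol_regular usol Pab.
exists ut, ux, uxx; split => // i iP t x t0; move: x.
apply: (within_itv_eq ab).
- have utc' := within_slice t0 utc; have uxxc' := within_slice t0 uxxc.
  by move=> z; apply: cvgB; [exact: utc'|apply: cvgM; [exact: cvg_cst|exact: uxxc']].
- have fc : continuous (if i then f1 else f2) by case: i {iP}; exact: continuous_C1.
  have uc : {within `[a, b], continuous (u t)}.
    by apply: (@deriv_within_continuous _ _ _ (ux t)) => y yab; have [] := J t y t0 yab.
  move=> z; apply: (@continuous_comp (subspace `[a, b]%classic) R R (u t)).
    exact: uc.
  exact: fc.
- move=> x xab.
  have := sol_equation usol t0 (interior_not_interface l10 l20 Pab xab).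
  rewrite !(iP _ _ _ _ xab) => <-.
  have xab' : a <= x <= b by lra.
  have [Jt _ _] := J t x t0 xab'.
  congr (_ - _ * _); first by rewrite derive1E derive_val.
  apply/esym; apply: (derive2_interior _ _ xab) => y yab.
    by have [_ Jx _] := J t y t0 yab; exact: Jx.
  by have [_ _ Jxx] := J t y t0 yab; exact: Jxx.
Qed.

Lemma eigenfunction_on_patch (R : realType) (l1 l2 d1 d2 sigma lambda a b : R)
    (f1 f2 phi : R -> R) :
  0 < l1 -> 0 < l2 ->
  principal_eigenfunction l1 l2 d1 d2 sigma f1 f2 lambda phi ->
  Defs.patch l1 l2 a b ->
  exists phi1 phi2,
    [/\ forall x, a <= x <= b -> deriv_within `[a, b] phi x (phi1 x),
        forall x, a <= x <= b -> deriv_within `[a, b] phi1 x (phi2 x) &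
    forall i : bool,
      (forall (T : Type) (v1 v2 : T) x, a < x < b ->
        patchwise l1 l2 v1 v2 x = if i then v1 else v2) ->
      forall x, a <= x <= b ->
      - (if i then d1 else d2) * phi2 x =
        ((if i then f1 else f2)^`() 0 + lambda) * phi x].
Proof.
move=> l10 l20 eig Pab.
have ab := tile_lt (tiling_patch l10 l20) Pab.
have [fn [fn0 fnS]] := eig_regular eig Pab.
have D k x : a <= x <= b -> deriv_within `[a, b] (fn k) x (fn k.+1 x).
  by move=> xab; apply: fnS; rewrite /= in_itv.
have Dc k : {within `[a, b], continuous (fn k)}.
  by apply: deriv_within_continuous => x; rewrite /= in_itv; exact: D.
exists (fn 1%N), (fn 2%N); split; [by rewrite -fn0; exact: D|exact: D|].
move=> i iP; apply: (within_itv_eq ab).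
- by move=> z; apply: cvgM; [exact: cvg_cst|exact: Dc].
- by rewrite -fn0; move=> z; apply: cvgM; [exact: cvg_cst|exact: Dc].
- move=> x xab.
  have := eig_equation eig (interior_not_interface l10 l20 Pab xab).
  rewrite !(iP _ _ _ _ xab) -fn0 (derive2_interior (D 0%N) (D 1%N) xab).
  by move=> H; rewrite mulrDl -H; ring.
Qed.

(** On S1 and on S2 the ratio of the slopes is sigma or its inverse. The same
    factor serves for all functions, so that a linear combination of the solution and the
    eigenfunction inherits the condition. *)
Lemma transmission_factor (R : realType) (l1 l2 sigma x : R) :
  0 < sigma -> interfaces l1 l2 x ->
  exists2 s, 0 < s & forall g : R -> R,
    (S1 l1 l2 x -> left_lim g x = sigma * right_lim g x) ->
    (S2 l1 l2 x -> sigma * left_lim g x = right_lim g x) ->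
    left_lim g x = s * right_lim g x.
Proof.
move=> s0 [] xS; first by exists sigma => // g + _; exact.
exists sigma^-1; first by rewrite invr_gt0.
by move=> g _ /(_ xS) <-; rewrite mulKf// gt_eqF.
Qed.

(** The difference v of the two sides satisfies
    v_t - d v_xx = al f(u) - (f_s(x, 0) + lambda - mu) w.  The coefficients [al] and [c]
    are kept free: (1, delta) bounds the solution from above and (-1, 0) shows that it
    is nonnegative. *)
Lemma comparison_eigenfunction (R : realType) (l1 l2 d1 d2 sigma lambda : R)
    (f1 f2 u0 phi : R -> R) (u : R -> R -> R) (al c mu M T B : R) :
  0 < l1 -> 0 < l2 -> 0 < d1 -> 0 < d2 -> 0 < sigma -> C1 f1 -> C1 f2 ->
  patch_solution l1 l2 d1 d2 sigma f1 f2 u0 u ->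
  principal_eigenfunction l1 l2 d1 d2 sigma f1 f2 lambda phi ->
  0 <= M -> 0 <= B ->
  let w t x := c * expR (- mu * t) * phi x in
  (forall t x, 0 <= t <= T -> al * u t x - w t x <= B) ->
  (forall x, al * u0 x - w 0 x <= 0) ->
  (forall f t x, f = f1 \/ f = f2 -> 0 < t <= T -> w t x < al * u t x ->
    al * f (u t x) - (f^`() 0 + lambda - mu) * w t x <=
      M * (al * u t x - w t x)) ->
  forall t x, 0 <= t <= T -> al * u t x <= w t x.
Proof.
move=> l10 l20 d10 d20 s0 f1C f2C usol eig M0 B0 w vB v0 fM t x tT.
have PP := tiling_patch l10 l20.
have [kappa k0 [psi [psi1 [psi2 pen]]]] := penalty_patch l10 l20.
pose v t x := al * u t x - w t x.
have vE t' : v t' = fun x => al * u t' x + - (c * expR (- mu * t')) * phi x.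
  by apply/funext => y; rewrite /v /w; ring.
rewrite -subr_le0 -/(v t x).
apply: (@parabolic_max_principle R _ kappa psi psi1 psi2 (d1 + d2) M T B v PP pen
  k0 _ M0 B0 _ vB _ _ _ t x tT).
- by rewrite addr_ge0// ltW.
- have uc := sol_continuous usol.
  have wc : continuous (fun z : R * R => w z.1 z.2).
    move=> z; apply: cvgM; [apply: cvgM; first exact: cvg_cst|].
      apply: (@continuous_comp _ _ _ (fun z : R * R => - mu * z.1) expR).
        by apply: cvgM; [exact: cvg_cst|exact: cvg_fst].
      exact: continuous_expR.
    apply: (@continuous_comp _ _ _ snd phi); [exact: cvg_snd|].
    by have := eig_continuous eig; exact.
  move=> z; apply: cvgB; first by apply: cvgM; [exact: cvg_cst|exact: uc].
  by move: z; apply: continuous_subspaceT => z; exact: wc.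
- by move=> y; rewrite /v (sol_initial usol).
- move=> a b Pab.
  have [i iP] := patchwise_patch l10 l20 Pab.
  have [ut [ux [uxx [J ueq]]]] := solution_on_patch l10 l20 f1C f2C usol Pab.
  have [phi1 [phi2 [dphi ddphi phieq]]] := eigenfunction_on_patch l10 l20 eig Pab.
  exists (fun t x => al * ut t x + mu * w t x).
  exists (fun t x => al * ux t x + - (c * expR (- mu * t)) * phi1 x).
  exists (fun t x => al * uxx t x + - (c * expR (- mu * t)) * phi2 x).
  split.
    move=> t' y t'0 yab; have [Jt Jx Jxx] := J t' y t'0 yab; split.
    - rewrite /v /w; apply: is_derive_eq; rewrite /GRing.scale/=; ring.
    - by rewrite vE; apply: deriv_within_lincomb => //; exact: dphi.
    - by apply: deriv_within_lincomb => //; exact: ddphi.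
  exists (if i then d1 else d2); first by case: (i); rewrite ?ltW//=; lra.
  move=> t' y t'T yab vpos.
  have t'0 : 0 < t' by case/andP: t'T.
  have ff : (if i then f1 else f2) = f1 \/ (if i then f1 else f2) = f2.
    by case: (i); [left|right].
  have := fM _ _ y ff t'T; rewrite -subr_gt0 => /(_ vpos).
  rewrite -(ueq _ iP _ _ t'0 yab) -/(v t' y); apply: le_trans.
  have := phieq _ iP _ yab.
  set F := _^`() 0; set dd := if i then d1 else d2 => H.
  rewrite le_eqVlt; apply/orP; left; apply/eqP.
  transitivity (al * (ut t' y - dd * uxx t' y) + mu * w t' y
    - c * expR (- mu * t') * (- dd * phi2 y)); first by ring.
  by rewrite H /w; ring.
- move=> a y b t' m p Pay Pyb t'0 vm vp.
  have ay := tile_lt PP Pay; have yb := tile_lt PP Pyb.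
  have [_ yS] := patch_ends Pay.
  have [ut [ux [uxx [J _]]]] := solution_on_patch l10 l20 f1C f2C usol Pay.
  have [phi1 [phi2 [dphi ddphi _]]] := eigenfunction_on_patch l10 l20 eig Pay.
  have [ut' [ux' [uxx' [J' _]]]] := solution_on_patch l10 l20 f1C f2C usol Pyb.
  have [phi1' [phi2' [dphi' ddphi' _]]] := eigenfunction_on_patch l10 l20 eig Pyb.
  have [s spos sP] := transmission_factor s0 yS; exists s => //.
  have us : ux t' y = s * ux' t' y.
    rewrite -(left_lim_derive1 ay (g := u t') (dg := ux t')
      (ddg := uxx t')); last 2 first.
    - by move=> z zay; have [_ Jz _] := J t' z t'0 zay.
    - by move=> z zay; have [_ _ Jz] := J t' z t'0 zay.
    rewrite -(right_lim_derive1 yb (g := u t') (dg := ux' t')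
      (ddg := uxx' t')); last 2 first.
    - by move=> z zyb; have [_ Jz _] := J' t' z t'0 zyb.
    - by move=> z zyb; have [_ _ Jz] := J' t' z t'0 zyb.
    by apply: sP => yS'; [have [] := sol_interface1 usol t'0 yS'
                         |have [] := sol_interface2 usol t'0 yS'].
  have ps : phi1 y = s * phi1' y.
    rewrite -(left_lim_derive1 ay dphi ddphi) -(right_lim_derive1 yb dphi' ddphi').
    by apply: sP => yS'; [exact: (eig_interface1 eig)|exact: (eig_interface2 eig)].
  have yay : a <= y <= y by rewrite lexx ltW.
  have yyb : y <= y <= b by rewrite lexx ltW.
  have -> : m = al * ux t' y + - (c * expR (- mu * t')) * phi1 y.
    apply: (deriv_within_unique ay yay vm); rewrite vE.
    by apply: deriv_within_lincomb; [have [] := J t' y t'0 yay|exact: dphi].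
  have -> : p = al * ux' t' y + - (c * expR (- mu * t')) * phi1' y.
    apply: (deriv_within_unique yb yyb vp); rewrite vE.
    by apply: deriv_within_lincomb; [have [] := J' t' y t'0 yyb|exact: dphi'].
  by rewrite us ps; ring.
Qed.

(** * Reactions near zero, sup norms and extinction *)

Lemma C1_lipschitz (R : realType) (f : R -> R) (B : R) : C1 f -> 0 <= B ->
  exists2 M, 0 <= M & forall x y, - B <= x -> x < y -> y <= B ->
    `|f y - f x| <= M * (y - x).
Proof.
move=> [fd f'c] B0.
have [||c _ cP] := @EVT_max R (Num.norm \o f^`()) (- B) B; first by lra.
  apply: continuous_subspaceT => x; apply: continuous_comp; first exact: f'c.
  exact: norm_continuous.
exists `|f^`() c| => // x y Bx xy yB.
have [||z] := @MVT R f f^`() x y xy.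
- by move=> z _; rewrite derive1E; exact/derivableP.
- apply: derivable_within_continuous => z _; exact: fd.
rewrite in_itv/= => /andP[xz zy] ->.
rewrite normrM (gtr0_norm (_ : 0 < y - x)); last by rewrite subr_gt0.
apply: ler_wpM2r; first by rewrite subr_ge0 ltW.
by apply: (cP z); rewrite in_itv/=; lra.
Qed.

(** Differentiability at 0 alone: f(s) / s tends to f'(0). *)
Lemma C1_le_near0 (R : realType) (f : R -> R) (e : R) : C1 f -> f 0 = 0 -> 0 < e ->
  exists2 r, 0 < r & forall s, 0 <= s <= r -> f s <= (f^`() 0 + e) * s.
Proof.
move=> [fd _] f0 e0.
have /(@deriv_within_is_derive R setT)/deriv_withinP : is_derive (0 : R) 1 f (f^`() 0).
  by rewrite derive1E; exact/derivableP.
move=> /(_ e e0)[r r0 rP].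
exists (r / 2) => [|s]; first by rewrite divr_gt0.
move=> /andP[]; rewrite le_eqVlt => /orP[/eqP <-|s0 sr]; first by rewrite f0 mulr0.
have := rP s I; rewrite gt_eqF// subr0 f0 subr0 gtr0_norm// => /(_ isT).
have -> : s < r by lra.
move=> /(_ isT); rewrite ltr_norml => /andP[_]; rewrite ltrBlDl ltr_pdivrMr//.
exact: ltW.
Qed.

Lemma Linfty_norm_le (R : realType) (g : R -> R) (C : R) : (forall x, `|g x| <= C) ->
  (Linfty_norm g <= C%:E)%E.
Proof.
move=> gC; rewrite /Linfty_norm unlock /=; case: ifPn => _.
  by apply/ess_supP/nearW => x /=; rewrite lee_fin.
by rewrite lee_fin; exact: le_trans (gC 0).
Qed.

(** A continuous function exceeding a level at one point exceeds it on an
    interval, which has positive measure. *)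
Lemma le_Linfty_norm (R : realType) (g : R -> R) (C x : R) : continuous g ->
  (Linfty_norm g <= C%:E)%E -> g x <= C.
Proof.
move=> gc; rewrite /Linfty_norm unlock /= ifT; last first.
  by rewrite -set_itvNyy lebesgue_measure_itv/= addye// ltry.
move=> /ess_supP[N [mN N0 gN]]; rewrite leNgt; apply/negP => Cgx.
have [r /= r0 rP] : nbhs x [set y | C < g y].
  exact: cvgr_gt (gc x) _ Cgx.
pose J : set R := `]x - r, x + r[%classic.
have : (lebesgue_measure J <= lebesgue_measure N)%E.
  apply: le_measure; rewrite ?inE//; first exact: measurable_itv.
  move=> y; rewrite /J/= in_itv/= => yr; apply: gN => /=.
  apply/negP; rewrite -ltNge lte_fin; apply: lt_le_trans (ler_norm _).
  by apply: rP; rewrite /= distrC ltr_norml; lra.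
rewrite N0 /J lebesgue_measure_itv/= lte_fin.
rewrite ifT; last by lra.
by rewrite lee_fin; lra.
Qed.

Lemma periodic_bounds (R : realType) (phi : R -> R) (l : R) : 0 < l ->
  continuous phi -> (forall x, phi (x + l) = phi x) ->
  exists xm xM, forall x, phi xm <= phi x <= phi xM.
Proof.
move=> l0 phic phil.
have pc : {within `[0, l], continuous phi} by exact: continuous_subspaceT.
have [xm _ mP] := EVT_min (ltW l0) pc.
have [xM _ MP] := EVT_max (ltW l0) pc.
exists xm, xM => x.
have /andP[] := floor_itv (x / l); set n := Num.floor _.
rewrite ler_pdivlMr// ltr_pdivrMr// intrD mulrDl mul1r => nx xn.
have xl : x - n%:~R * l \in `[0, l] by rewrite in_itv/=; lra.
have -> : phi x = phi (x - n%:~R * l).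
  by rewrite -{1}(subrK (n%:~R * l) x) (periodicz phil).
by rewrite mP// MP.
Qed.

Lemma cvg_expRN (R : realType) (c m : R) : 0 < m ->
  (c * expR (- m * t))%:E @[t --> +oo] --> 0%E.
Proof.
move=> m0; apply: cvg_EFin; first by apply: nearW => t.
rewrite -[X in _ --> X](mulr0 c); apply: cvgMl_tmp.
have mt : m * t @[t --> +oo] --> +oo.
  apply/cvgryPge => A; apply: filterS (nbhs_pinfty_ge (num_real (A / m))) => t.
  by rewrite ler_pdivrMr// mulrC.
have := cvg_comp _ _ mt (@cvgr_expR R).
by apply: cvg_trans; apply: near_eq_cvg; apply: nearW => t /=; rewrite mulNr.
Qed.

Theorem theorem2p6 (R : realType) (l1 l2 d1 d2 sigma : R)
    (f1 f2 : R -> R) (K1 K2 theta lambda1 : R)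
    (l1_gt0 : 0 < l1) (l2_gt0 : 0 < l2) (d1_gt0 : 0 < d1) (d2_gt0 : 0 < d2)
    (sigma_gt0 : 0 < sigma)
    (f1_KPP : KPP f1 K1) (f2_bistable : bistable f2 theta K2)
    (lambda1P : principal_eigenvalue l1 l2 d1 d2 sigma f1 f2 lambda1)
    (lambda1_gt0 : 0 < lambda1) :
  exists2 eps : R, 0 < eps &
    forall (u0 : R -> R) (u : R -> R -> R),
      (forall x : R, 0 <= u0 x) ->
      continuous u0 ->
      compact (closure [set x | u0 x != 0]) ->
      (exists x : R, u0 x != 0) ->
      (Linfty_norm u0 <= eps%:E)%E ->
      patch_solution l1 l2 d1 d2 sigma f1 f2 u0 u ->
      Linfty_norm (u t) @[t --> +oo] --> 0%E.
Proof.
have [phi eig] := lambda1P.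
have f1C := kpp_C1 f1_KPP; have f2C := bistable_C1 f2_bistable.
have f10 := kpp_f0 f1_KPP; have f20 := bistable_f0 f2_bistable.
have l0 : 0 < l1 + l2 by lra.
have [xm [xM phib]] := periodic_bounds l0 (eig_continuous eig) (eig_periodic eig).
have phi0 := eig_gt0 eig.
pose mu := lambda1 / 2; have mu0 : 0 < mu by rewrite divr_gt0.
have [r [r0 fr]] : exists r, 0 < r /\ forall f, f = f1 \/ f = f2 ->
    forall s, 0 <= s <= r -> f s <= (f^`() 0 + mu) * s.
  have [r1 r10 P1] := C1_le_near0 f1C f10 mu0.
  have [r2 r20 P2] := C1_le_near0 f2C f20 mu0.
  exists (Num.min r1 r2); split; first by rewrite lt_min r10.
  by move=> f [] -> s /andP[s0]; rewrite le_min => /andP[s1 s2];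
    [apply: P1|apply: P2]; rewrite s0.
(* Then delta phi <= r, the range where the reactions are controlled. *)
pose delta := r / phi xM; have delta0 : 0 < delta by rewrite divr_gt0.
exists (delta * phi xm); first by rewrite mulr_gt0.
move=> u0 u u0_ge0 u0c _ _ u0eps usol.
have u0le x : u0 x <= delta * phi x.
  apply: (le_trans (le_Linfty_norm x u0c u0eps)).
  by rewrite ler_pM2l//; have /andP[] := phib x.
have wr t x : 0 <= t -> 0 < delta * expR (- mu * t) * phi x <= r * expR (- mu * t).
  move=> t0; rewrite (mulr_gt0 (mulr_gt0 delta0 (expR_gt0 _)) (phi0 x))/=.
  rewrite mulrAC ler_pM2r ?expR_gt0// /delta mulrAC ler_pdivrMr//.
  by rewrite ler_pM2l//; have /andP[] := phib x.
have er t : 0 <= t -> r * expR (- mu * t) <= r.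
  move=> t0; apply: ler_piMr; first exact: ltW.
  rewrite -expR0 ler_expR mulNr oppr_le0.
  by rewrite mulr_ge0// ltW.
have bounds T : 0 < T -> forall x, 0 <= u T x <= r * expR (- mu * T).
  move=> T0 x.
  have [B [B0 uB]] : exists B, 0 <= B /\ forall t x, 0 <= t <= T -> `|u t x| <= B.
    have [B B0 uB] := ex_strict_bound_gt0 (sol_bounded usol T0).
    exists B; split; first exact: ltW.
    by move=> t y tT; exact/ltW/(uB (t, y)).
  (* u may be large on [0, T]: the Lipschitz constant depends on T, but the
     bound that is obtained does not. *)
  have [M [M0 fM]] : exists M, 0 <= M /\ forall f, f = f1 \/ f = f2 ->
      forall x y, - (B + r) <= x -> x < y -> y <= B + r ->
      `|f y - f x| <= M * (y - x).
    have Br0 : 0 <= B + r by lra.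
    have [M1 M10 P1] := C1_lipschitz f1C Br0.
    have [M2 M20 P2] := C1_lipschitz f2C Br0.
    exists (M1 + M2); split; first by lra.
    move=> f ff y z yB yz zB; have yz0 : 0 <= z - y by lra.
    have := mulr_ge0 M10 yz0; have := mulr_ge0 M20 yz0.
    have := P1 _ _ yB yz zB; have := P2 _ _ yB yz zB.
    by case: ff => ->; rewrite mulrDl; lra.
  have TT : 0 <= T <= T by rewrite lexx ltW.
  apply/andP; split.
    have := @comparison_eigenfunction R l1 l2 d1 d2 sigma lambda1 f1 f2 u0 phi u
      (-1) 0 mu M T B l1_gt0 l2_gt0 d1_gt0 d2_gt0 sigma_gt0 f1C f2C usol eig M0 B0.
    move=> /= /(_ _ _ _ T x TT); rewrite !mul0r mulN1r oppr_le0; apply.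
    - move=> t y tT; rewrite !mul0r subr0 mulN1r.
      by apply: le_trans (uB t y tT); rewrite -normrN; exact: ler_norm.
    - by move=> y; rewrite !mul0r subr0 mulN1r oppr_le0.
    - move=> f t y ff tT; rewrite !mul0r mulr0 !subr0 !mulN1r oppr_gt0 => u_lt0.
      have f0 : f 0 = 0 by case: ff => ->.
      have := uB t y; have -> : 0 <= t <= T by lra.
      move=> /(_ isT); rewrite ler_norml => /andP[uB1 uB2].
      have := fM f ff (u t y) 0; rewrite f0 !sub0r normrN => H.
      apply: (le_trans (y := `|f (u t y)|)); first by rewrite -normrN ler_norm.
      by apply: H => //; lra.
  have /andP[_ wT] := wr T x (ltW T0); apply: le_trans wT.
  have := @comparison_eigenfunction R l1 l2 d1 d2 sigma lambda1 f1 f2 u0 phi u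
    1 delta mu M T B l1_gt0 l2_gt0 d1_gt0 d2_gt0 sigma_gt0 f1C f2C usol eig M0 B0.
  move=> /= /(_ _ _ _ T x TT); rewrite mul1r; apply.
  - move=> t y tT; rewrite mul1r; have t0 : 0 <= t by case/andP: tT.
    have := uB t y tT; have /andP[] := wr t y t0; have := ler_norm (u t y); lra.
  - by move=> y; rewrite mul1r mulr0 expR0 mulr1 subr_le0.
  - move=> f t y ff tT; rewrite !mul1r; set w := delta * _ * _ => wu.
    have t0 : 0 <= t by case/andP: tT => /ltW.
    have /andP[w0 wr'] : 0 < w <= r * expR (- mu * t) := wr t y t0.
    have er' := er t t0.
    have fw : f w <= (f^`() 0 + mu) * w by apply: (fr f ff); lra.
    have uBt : `|u t y| <= B by apply: uB; lra.
    have uB' := ler_norm (u t y).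
    have : `|f (u t y) - f w| <= M * (u t y - w) by apply: (fM f ff) => //; lra.
    have := ler_norm (f (u t y) - f w).
    have -> : f^`() 0 + lambda1 - mu = f^`() 0 + mu by rewrite /mu; field.
    lra.
apply: (squeeze_cvge _ (cvg_cst _) (cvg_expRN r mu0)).
apply: filterS (nbhs_pinfty_gt (num_real 0)) => t t0.
rewrite Lnorm_ge0/=; apply: Linfty_norm_le => x.
by have /andP[u_ge0 u_le] := bounds t t0 x; rewrite ger0_norm.
Qed.
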